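(* There exist $2^\omega$ pairwise non-isomorphic Egorov ideals (on a countable set) each of which is $\mathbf{\Pi^0_\omega}$.
   Context: An ideal on a countable set $X$ is a family $\mathcal{I}\subseteq\mathcal{P}(X)$ closed under finite unions and subsets, containing all finite subsets of $X$, with $X\notin\mathcal{I}$; $\mathcal{P}(X)$ is identified with $2^X$ with the product topology, and $\mathbf{\Pi^0_\omega}$ refers to the Borel class in this space (countable intersections of sets in $\bigcup_{n}\mathbf{\Sigma^0_n}$). Ideals $\mathcal{I}$ on $X$ and $\mathcal{J}$ on $Y$ are isomorphic if there is a bijection $f:Y\to X$ with $A\in\mathcal{I}\iff f^{-1}[A]\in\mathcal{J}$ for all $A\subseteq X$. For an ideal $\mathcal{I}$ on a countable set $S$ and functions $f_s,f:Y\to\mathbb{R}$: $(f_s)_{s\in S}$ is $\mathcal{I}$-pointwise convergent to $f$ if for all $y$ and $\varepsilon>0$, $\{s:|f_s(y)-f(y)|\ge\varepsilon\}\in\mathcal{I}$; $\mathcal{I}$-uniformly convergent if for all $\varepsilon>0$, $\{s:\exists y\ |f_s(y)-f(y)|\ge\varepsilon\}\in\mathcal{I}$. $\mathcal{I}$ is Egorov if for every family $(f_s)_{s\in S}$ of Lebesgue measurable functions $[0,1]\to\mathbb{R}$ $\mathcal{I}$-pointwise convergent to a Lebesgue measurable $f$ and every $\eta>0$ there is a measurable $M\subseteq[0,1]$ with $\lambda([0,1]\setminus M)<\eta$ such that $(f_s\restriction M)$ is $\mathcal{I}$-uniformly convergent to $f\restriction M$. *)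

(* Defs.v *)
From HB Require Import structures.
From mathcomp Require Import all_boot all_order all_algebra.
From mathcomp Require Import all_classical all_reals all_analysis.
Import Order.TTheory GRing.Theory Num.Theory.
Import numFieldNormedType.Exports.

Set Implicit Arguments.
Unset Strict Implicit.
Unset Printing Implicit Defensive.

Local Open Scope classical_set_scope.
Local Open Scope ring_scope.

Record is_ideal (X : countType) (I : set (set X)) : Prop := IsIdeal {
  idealU : forall A B, I A -> I B -> I (A `|` B) ;
  idealS : forall A B, A `<=` B -> I B -> I A ;
  ideal_fin : forall A, finite_set A -> I A ;
  idealNT : ~ I setT }.

Definition ideal_iso (X Y : countType) (I : set (set X)) (J : set (set Y)) :
    Prop :=
  exists f : Y -> X, bijective f /\ forall A : set X, I A <-> J (f @^-1` A).

Section borel_classes.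
Context {T : topologicalType}.

(* The level 0 of [Sigma0] is empty, so the sets [F i] below are Pi^0_m sets
   for some m with 1 <= m < n. *)
Inductive Sigma0 : nat -> set (set T) :=
| Sigma0_open U : open U -> Sigma0 1%N U
| Sigma0_bigcup n (m : nat -> nat) (F : nat -> set T) :
    (forall i, (m i < n)%N) -> (forall i, Sigma0 (m i) (~` F i)) ->
    Sigma0 n (\bigcup_i F i).

Definition Pi0_omega (A : set T) : Prop :=
  exists2 F : nat -> set T,
    (forall i, exists n, Sigma0 n (F i)) & A = \bigcap_i F i.

End borel_classes.

Definition powerset_family (X : countType) (I : set (set X)) :
    set (prod_topology (fun _ : X => bool)) :=
  [set b : prod_topology (fun _ : X => bool) | I [set x | b x]].

Definition ideal_pointwise_cvg (R : realType) (S : countType) (Y : Type)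
    (I : set (set S)) (D : set Y) (f_ : S -> Y -> R) (f : Y -> R) : Prop :=
  forall y, D y -> forall e : R, 0 < e -> I [set s | e <= `|f_ s y - f y|].

Definition ideal_uniform_cvg (R : realType) (S : countType) (Y : Type)
    (I : set (set S)) (D : set Y) (f_ : S -> Y -> R) (f : Y -> R) : Prop :=
  forall e : R, 0 < e ->
    I [set s | exists2 y, D y & e <= `|f_ s y - f y|].

(* The default measurable sets of a [realType] are the Borel sets; this type
   carries the Lebesgue sigma-algebra, on which [completed_lebesgue_measure]
   is defined. *)
Definition lebesgueR (R : realType) :=
  caratheodory_type ((wlength (@idfun R))^*)%mu.
HB.instance Definition _ (R : realType) := Measurable.on (lebesgueR R).

Definition unit_itv (R : realType) : set (lebesgueR R) :=
  `[(0 : R), (1 : R)]%classic.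
Arguments unit_itv R : clear implicits.

(* Functions on [0, 1] are represented by functions on the whole line whose
   values outside [0, 1] are irrelevant. *)
Definition Egorov (R : realType) (S : countType) (I : set (set S)) : Prop :=
  forall (f_ : S -> lebesgueR R -> R) (f : lebesgueR R -> R),
    (forall s, measurable_fun (unit_itv R) (f_ s)) ->
    measurable_fun (unit_itv R) f ->
    ideal_pointwise_cvg I (unit_itv R) f_ f ->
  forall eta : R, 0 < eta ->
  exists M : set (lebesgueR R),
    [/\ measurable M, M `<=` unit_itv R,
        (completed_lebesgue_measure (unit_itv R `\` M) < eta%:E)%E &
        ideal_uniform_cvg I M f_ f].

(* Main.v *)
(* For [a : nat -> bool] let I_a be the direct sum of Fin and of the Fubini
   powers Fin^(n+2) with [a n].

   The Egorov property of an ideal J is equivalent to its version for sets: if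
   the E_s are measurable and every fibre { s | y in E_s } is in J, then off a
   set of small measure the set of s such that E_s meets the rest is in J (apply
   this to E_s = { |f_s - f| >= 1/k } for each k). For Fin^(n+1) = Fin x Fin^n,
   the points y whose fibre is in Fin^n in every column from the N-th on
   increase with N to the whole interval, so some N captures almost all of
   them; then treat each later column by induction, with errors eta/2^k. Direct
   sums are treated in the same way.

   For n < m no positive restriction of Fin^n is Katetov above Fin^m. Hence an
   isomorphism from I_a to I_b sends the summand Fin^n of one to a set whose
   positive parts can only lie in a summand Fin^n of the other. *)

Require Import Defs.
From mathcomp Require Import all_boot all_order all_algebra.
From mathcomp Require Import all_classical all_reals all_analysis.
From mathcomp Require Import measurable_realfun.
Import Order.TTheory GRing.Theory Num.Theory.
Import numFieldNormedType.Exports.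

Set Implicit Arguments.
Unset Strict Implicit.
Unset Printing Implicit Defensive.

Local Open Scope classical_set_scope.

(** * Fubini powers and their direct sums as ideals *)

(* The iterated Fubini power Fin^n lives on the sequences of length [n]; its
   members are unconstrained on sequences of any other length. *)
Fixpoint fin_pow (n : nat) (A : set (seq nat)) : Prop :=
  if n is n.+1 then \forall k \near \oo, fin_pow n [set s | A (k :: s)]
  else ~ A [::].

(* Slot [0] is always occupied, so that the whole set is never in the ideal. *)
Definition slot (a : nat -> bool) (n : nat) : bool :=
  if n is n.+1 then a n else true.

(** As [fin_pow n.+1] sees only the sequences of length [n.+1], these form the summand in slot [n],
    and the same [A] can be tested in every slot. *)
Definition fin_pow_sum (a : nat -> bool) (A : set (seq nat)) : Prop :=
  forall n, slot a n -> fin_pow n.+1 A.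

Lemma fin_powS n (A B : set (seq nat)) :
  A `<=` B -> fin_pow n B -> fin_pow n A.
Proof.
elim: n A B => [|n IH] A B AB /=; first by move=> + /AB.
by apply: filterS => k; apply: IH => s /AB.
Qed.

Lemma fin_powU n (A B : set (seq nat)) :
  fin_pow n A -> fin_pow n B -> fin_pow n (A `|` B).
Proof.
elim: n A B => [|n IH] A B /=; first by move=> nA nB [].
by move=> fA fB; apply: filterS2 fA fB => k; exact: IH.
Qed.

Lemma fin_pow_set0 n : fin_pow n set0.
Proof. by elim: n => [|n IH] //=; exact: nearW. Qed.

Lemma fin_pow_bigcup n m (A : nat -> set (seq nat)) :
  (forall i, fin_pow n (A i)) -> fin_pow n (\bigcup_(i < m) A i).
Proof.
move=> fA; rewrite bigcup_mkord; elim/big_ind: _ => //.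
- exact: fin_pow_set0.
- by move=> B C; exact: fin_powU.
Qed.

Lemma fin_pow_finite n (A : set (seq nat)) :
  finite_set A -> fin_pow n.+1 A.
Proof.
move=> /finite_seqP[s ->] /=; exists (\max_(t <- s) head 0 t).+1 => //= k /=.
rewrite leqNgt => + ; apply: contraNP => fk; rewrite ltnNge.
apply/negP => lk; apply: fk; apply: fin_powS (fin_pow_set0 n) => t /= ts.
have := leq_bigmax_seq (P := xpredT) (F := head 0) _ ts isT.
by rewrite leqNgt /= lk.
Qed.

Lemma fin_powI_size n (A : set (seq nat)) :
  fin_pow n (A `&` [set s | size s = n]) -> fin_pow n A.
Proof.
elim: n A => [|n IH] A /=; first by move=> nA A0; exact: nA.
apply: filterS => k fA; apply: IH; apply: fin_powS fA => s /= [As ->] //.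
Qed.

Lemma fin_pow_size_neq n m (A : set (seq nat)) : n <> m ->
  (forall s, A s -> size s = m) -> fin_pow n A.
Proof.
move=> nm Am; apply: fin_powI_size; apply: fin_powS (fin_pow_set0 n) => s.
by move=> [/Am sm /= sn]; apply: nm; rewrite -sn.
Qed.

Lemma fin_pow_setT n : ~ fin_pow n setT.
Proof. by elim: n => [|n IH] /=; [exact|case=> N _ /(_ N (leqnn N))/IH]. Qed.

Lemma fin_pow_sum_ideal a : @is_ideal (seq nat) (fin_pow_sum a).
Proof.
split.
- by move=> A B IA IB n an; apply: fin_powU; [exact: IA|exact: IB].
- by move=> A B AB IB n an; apply: fin_powS AB _; exact: IB.
- by move=> A fA n _; exact: fin_pow_finite.
- by move=> /(_ 0%N isT)/fin_pow_setT.
Qed.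

(** * Katetov order and non-isomorphism *)

(* Together with the monotonicity of the Katetov order, this says that Fin^m is
   not Katetov below the restriction of Fin^n to any positive set. *)
Lemma fin_pow_not_katetov n m (C : set (seq nat)) (f : seq nat -> seq nat) :
  (n < m)%N -> ~ fin_pow n C ->
  exists2 A, fin_pow m A & ~ fin_pow n (C `&` f @^-1` A).
Proof.
elim: n m C f => [|n IH] [|m] // C f nm nC.
  (* Positive for [fin_pow 0] means containing [[::]], so the singleton of its image works. *)
  exists [set f [::]]; first by apply: fin_pow_finite; exact: finite_set1.
  by move=> /= nCf; apply: nC => C0; exact: nCf.
apply: contrapT => noA.
(* The columns below [j] form a set in Fin^(m+1), so by [noA] their preimage in [C] is small.
   Discarding it leaves some column of [C] beyond [j] positive, and induction applies to the
   tails. *)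
have key j : exists p : nat * set (seq nat), [/\ (j <= p.1)%N, fin_pow m p.2 &
    ~ fin_pow n [set s | [/\ C (p.1 :: s), (j <= head 0 (f (p.1 :: s)))%N &
                             p.2 (behead (f (p.1 :: s)))]]].
  have fB : fin_pow n.+1 (C `&` f @^-1` [set t | (head 0 t < j)%N]).
    apply: contrapT => nB; apply: noA; exists [set t | (head 0 t < j)%N] => //=.
    exists j => //= i /= ji; apply: fin_powS (fin_pow_set0 m) => s /=.
    by rewrite ltnNge ji.
  have [k [jk nCk]] : exists k, (j <= k)%N /\
      ~ fin_pow n [set s | C (k :: s) /\ (j <= head 0 (f (k :: s)))%N].
    apply: contrapT => nok; apply: nC => /=.
    have fC : \forall k \near \oo,
        fin_pow n [set s | C (k :: s) /\ (j <= head 0 (f (k :: s)))%N].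
      by exists j => //= k /= jk; apply: contrapT => H; apply: nok; exists k.
    move: fB => /= fB; apply: filterS2 fB fC => k fB fC.
    apply: fin_powS (fin_powU fB fC) => s /= Cs.
    by case: (ltnP (head 0 (f (k :: s))) j) => ?; [left|right].
  have [A mA nA] := IH m _ (fun s => behead (f (k :: s))) nm nCk.
  exists (k, A); split => //=; apply: contra_not nA; apply: fin_powS => s /=.
  by move=> [[]].
move/choice: key => [p hp].
(* Diagonal set: its column [i] is the union of the finitely many [(p j).2] with [j <= i], while its
   preimage is positive in column [(p N).1] of [C], hence in arbitrarily late columns. *)
apply: noA; exists [set t | exists2 j, (j <= head 0 t)%N & (p j).2 (behead t)].
  exists 0%N => // i _.
  apply: (@fin_powS _ _ (\bigcup_(j < i.+1) (p j).2)).
    by move=> s /= [j ji pj]; exists j.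
  by apply: fin_pow_bigcup => j; have [] := hp j.
move=> /= -[N _ /(_ (p N).1)] /=; have [Np _ nN] := hp N.
move=> /(_ Np); apply: contra_not nN; apply: fin_powS => s [Cs js ps].
by split => //; exists N.
Qed.

(** Turns a set that is small in one slot into a member of the whole sum: after the restriction,
    every other slot sees the empty set. *)
Lemma fin_pow_sum_slice a n (A : set (seq nat)) :
  fin_pow n.+1 A -> fin_pow_sum a ([set s | size s = n.+1] `&` A).
Proof.
move=> nA m _; have [->|mn] := eqVneq m n.
  by apply: fin_powS nA => s [].
by apply: (@fin_pow_size_neq _ n.+1) => [[]|s []//]; exact/eqP.
Qed.

Lemma fin_pow_sum_not_iso_slot a b n : slot b n -> ~~ slot a n ->
  ~ @ideal_iso (seq nat) (seq nat) (fin_pow_sum a) (fin_pow_sum b).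
Proof.
move=> bn an [f [[g fK gK] fI]].
have gI A : fin_pow_sum b A -> fin_pow_sum a (g @^-1` A).
  move=> bA; apply/fI.
  by rewrite -comp_preimage (_ : g \o f = id)//; exact/funext.
pose C := [set s : seq nat | size s = n.+1].
have nC : ~ fin_pow n.+1 C.
  move=> fC; apply: (@fin_pow_setT n.+1); apply: fin_powI_size.
  by rewrite setTI.
have [m am nm] : exists2 m, slot a m & ~ fin_pow m.+1 (g @^-1` C).
  apply: contrapT => H; apply: nC; suff: fin_pow_sum b C by exact.
  rewrite -(_ : f @^-1` (g @^-1` C) = C).
    by apply/fI => m am; apply: contrapT => nm; apply: H; exists m.
  by rewrite -comp_preimage (_ : g \o f = id)//; exact/funext.
have [mn|nltm|mn] := ltngtP m n.
- have [A nA] := @fin_pow_not_katetov m.+1 n.+1 _ g mn nm.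
  by apply; exact: (gI _ (fin_pow_sum_slice nA) m am).
(* Now the smaller power is on the side of [b], so [f] serves as the Katetov map, on the part of [C]
   that it sends to slot [m]. If this part were small, so would be its image, contradicting [nm]. *)
- pose C' := C `&` f @^-1` [set s | size s = m.+1].
  have nC' : ~ fin_pow n.+1 C'.
    move=> fC'; apply: nm; apply: fin_powI_size.
    apply: fin_powS (gI _ (fin_pow_sum_slice fC') m am) => s /= [Cs ms].
    by rewrite /C' /= gK.
  have [A mA] := @fin_pow_not_katetov n.+1 m.+1 _ f nltm nC'; apply.
  have /fI bA := fin_pow_sum_slice (a := a) mA; have := bA n bn.
  by apply: fin_powS => s /= [[_ ms] As].
- by rewrite mn (negbTE an) in am.
Qed.

Lemma fin_pow_sum_not_iso a b : a <> b ->
  ~ @ideal_iso (seq nat) (seq nat) (fin_pow_sum a) (fin_pow_sum b).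
Proof.
move=> ab iso; apply: ab; apply/funext => n.
have sub c d : @ideal_iso (seq nat) (seq nat) (fin_pow_sum c) (fin_pow_sum d) ->
    d n -> c n.
  move=> cd dn; apply/negPn/negP => cn.
  exact: (@fin_pow_sum_not_iso_slot c d n.+1).
have iso' : @ideal_iso (seq nat) (seq nat) (fin_pow_sum b) (fin_pow_sum a).
  have [f [[g fK gK] fI]] := iso; exists g; split; first by exists f.
  move=> A; split => [bA|/fI].
    by apply/fI; rewrite -comp_preimage (_ : g \o f = id)//; exact/funext.
  by rewrite -comp_preimage (_ : g \o f = id)//; exact/funext.
by apply/idP/idP; exact: sub.
Qed.

(** * Borel complexity *)

(** Each quantifier over almost all [k] is a union of intersections and costs two levels. The
    reindexing [g] lets the induction pass to columns. *)
Lemma Sigma0_fin_pow n (g : seq nat -> seq nat) :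
  Sigma0 n.*2.+1 [set b : prod_topology (fun _ : seq nat => bool) |
                   fin_pow n [set s | b (g s)]].
Proof.
elim: n g => [|n IH] g.
  apply: Sigma0_open => /=.
  rewrite (_ : mkset _ = proj (g [::]) @^-1` [set~ true]) //.
  by apply: open_comp; [move=> ? _; exact: proj_continuous|exact: discrete_open].
pose U k := [set b : prod_topology (fun _ : seq nat => bool) |
  fin_pow n [set s | b (g (k :: s))]].
rewrite (_ : mkset _ = \bigcup_N \bigcap_k U (N + k)%N).
  apply: (@Sigma0_bigcup _ _ (fun=> n.*2.+2)) => // N.
  rewrite setC_bigcap; apply: (@Sigma0_bigcup _ _ (fun=> n.*2.+1)) => // k.
  by rewrite setCK; exact: IH.
apply/seteqP; split => b /= [N _ HN]; exists N => //.
  by move=> k _; apply: HN => /=; exact: leq_addr.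
by move=> k /= Nk; have := HN (k - N)%N I; rewrite subnKC.
Qed.

Lemma fin_pow_sum_Pi0_omega a :
  Pi0_omega (@powerset_family (seq nat) (fin_pow_sum a)).
Proof.
exists (fun n => [set b : prod_topology (fun _ : seq nat => bool) |
                   slot a n -> fin_pow n.+1 [set s | b s]]).
  move=> n; case an : (slot a n); last first.
    exists 1%N; rewrite (_ : mkset _ = setT); last by apply/seteqP; split.
    exact/Sigma0_open/openT.
  exists n.+1.*2.+1; have := Sigma0_fin_pow n.+1 id; congr Sigma0.
  by apply/seteqP; split => b /= H; [move=> _|]; apply: H.
apply/seteqP; split => b /= H; first by move=> n _; exact: H.
by move=> n; exact: H n I.
Qed.

(** * The Egorov property *)

Local Open Scope ring_scope.

Definition almost_on d (T : measurableType d) (R : realType)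
    (mu : {measure set T -> \bar R}) (D : set T) (P : set T -> Prop) : Prop :=
  forall eta : R, (0 < eta)%R ->
  exists M, [/\ measurable M, M `<=` D, (mu (D `\` M) < eta%:E)%E & P M].

Section almost_on.
Context d (T : measurableType d) (R : realType).
Variables (mu : {measure set T -> \bar R}) (D : set T).
Hypotheses (mD : measurable D) (muD : (mu D < +oo)%E).

Lemma almost_on_forall (P : nat -> set T -> Prop) :
  (forall k M N, M `<=` N -> P k N -> P k M) ->
  (forall k, almost_on mu D (P k)) -> almost_on mu D (fun M => forall k, P k M).
Proof.
move=> Psub aP eta eta0.
(* The errors sum to at most [eta / 2]; the initial halving yields the strict bound by [eta]. *)
have e0 k : (0 < eta / 2 / (2 ^ k.+1)%:R)%R.
  by rewrite !divr_gt0// ltr0n expn_gt0.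
have /choice[M hM] k := aP k _ (e0 k).
have mM k : measurable (M k) by case: (hM k).
exists (\bigcap_k M k); split.
- exact: bigcapT_measurable.
- by move=> x /(_ 0%N I); have [_ + _ _] := hM 0%N; apply.
- have mDM k : measurable (D `\` M k) by exact: measurableD.
  apply: (@le_lt_trans _ _ (eta / 2)%:E); last first.
    by rewrite lte_fin ltr_pdivrMr// ltr_pMr// ltr1n.
  rewrite setDE setC_bigcap setI_bigcupr.
  apply: le_trans (epsilon_trick0 xpredT (ltW (divr_gt0 eta0 (ltr0n _ 2)))).
  apply: (@le_trans _ _ (\sum_(0 <= k <oo) mu (D `\` M k))%E).
    by apply: generalized_Boole_inequality => //; exact: bigcupT_measurable.
  by apply: lee_nneseries => // k _; have [_ _ /ltW + _] := hM k; apply.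
- by move=> k; have [_ _ _] := hM k; apply: Psub => x; apply.
Qed.

(** By continuity from above, which needs [muD], some [G N] misses less than [eta / 2] of [D]; the
    other half of [eta] is spent on the property relative to [G N]. *)
Lemma almost_on_increasing (G : nat -> set T) (P : set T -> Prop) :
  (forall N, measurable (G N)) -> {homo G : i j / (i <= j)%N >-> i `<=` j} ->
  D `<=` \bigcup_N G N ->
  (forall N, almost_on mu D (fun M => P (M `&` G N))) -> almost_on mu D P.
Proof.
move=> mG Ginc DG aP eta eta0.
have eta20 : (0 < eta / 2)%R by rewrite divr_gt0.
have [N muN] : exists N, (mu (D `\` G N) < (eta / 2)%:E)%E.
  have mDG N : measurable (D `\` G N) by exact: measurableD.
  have cap0 : \bigcap_N (D `\` G N) = set0.
    apply/seteqP; split => // x H; have [Dx _] := H 0%N I.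
    by have [N _ GNx] := DG x Dx; have [_] := H N I.
  have cvg0 : (mu \o (fun N => D `\` G N)) N @[N --> \oo] --> (0 : \bar R)%E.
    rewrite -(measure0 mu) -cap0; apply: nonincreasing_cvg_mu => //.
    - by apply: le_lt_trans muD; apply: le_measure; rewrite ?inE.
    - rewrite cap0; exact: measurable0.
    - by move=> i j ij; rewrite subsetEset; apply: setDS; exact: Ginc.
  have : \forall N \near \oo, (mu (D `\` G N) < (eta / 2)%:E)%E.
    by apply: (cvg0 [set x | (x < (eta / 2)%:E)%E]); exact: lt_nbhsl.
  by case=> N _ H; exists N; exact: (H N (leqnn N)).
have [M [mM MD muM PM]] := aP N _ eta20.
exists (M `&` G N); split => //.
- exact: measurableI.
- by move=> x [/MD].
- rewrite setDIr [eta]splitr EFinD.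
  apply: (@le_lt_trans _ _ (mu (D `\` M) + mu (D `\` G N))%E).
    by apply: measureU2; exact: measurableD.
  exact: lteD.
Qed.

Lemma measurable_fin_pow n (E : seq nat -> set T) :
  (forall s, measurable (E s)) ->
  measurable [set y | fin_pow n [set s | E s y]].
Proof.
elim: n E => [|n IH] E mE; first exact: measurableC (mE [::]).
rewrite (_ : mkset _ = \bigcup_N \bigcap_k
    [set y | fin_pow n [set s | E ((N + k)%N :: s) y]]).
  apply: bigcupT_measurable => N; apply: bigcapT_measurable => k.
  by apply: (IH (fun s => E ((N + k)%N :: s))) => s; exact: mE.
apply/seteqP; split => y /= [N _ HN]; exists N => //.
  by move=> k _; apply: HN => /=; exact: leq_addr.
by move=> k /= Nk; have := HN (k - N)%N I; rewrite /= subnKC.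
Qed.

Lemma fin_pow_almost_on n (E : seq nat -> set T) :
  (forall s, measurable (E s)) ->
  (forall y, D y -> fin_pow n [set s | E s y]) ->
  almost_on mu D (fun M => fin_pow n [set s | E s `&` M !=set0]).
Proof.
elim: n E => [|n IH] E mE fE.
  move=> eta eta0; exists D; split => //.
    by rewrite setDv measure0 lte_fin.
  by move=> [y [Ey Dy]]; exact: fE Dy Ey.
pose F k := [set y | fin_pow n [set s | E (k :: s) y]].
have mF k : measurable (F k).
  by apply: (measurable_fin_pow n (E := fun s => E (k :: s))).
pose G N := \bigcap_k F (N + k)%N.
have mG N : measurable (G N) by exact: bigcapT_measurable.
apply: (@almost_on_increasing G) => //.
- move=> i j ij y Gi k _; have := Gi (j - i + k)%N I.
  by rewrite addnA subnKC.
- move=> y /fE [N _ HN]; exists N => // k _.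
  by apply: HN => /=; exact: leq_addr.
move=> N.
have H : almost_on mu D (fun M => forall k,
    fin_pow n [set s | E ((N + k)%N :: s) `&` G N `&` M !=set0]).
  apply: (almost_on_forall (P := fun k M =>
    fin_pow n [set s | E ((N + k)%N :: s) `&` G N `&` M !=set0]))
      => [k M M' MM'|k].
    by apply: fin_powS => s [y [Ey /MM' My]]; exists y.
  (* Cutting with [G N] empties the fibres over points outside it, so the induction hypothesis
     applies on all of [D]. *)
  apply: (IH (fun s => E ((N + k)%N :: s) `&` G N)).
    by move=> s; exact: measurableI.
  move=> y Dy; have [GNy|nGNy] := pselect (G N y).
    by apply: fin_powS (GNy k I) => s [].
  by apply: fin_powS (fin_pow_set0 n) => s [].
move=> eta /H[M [mM MD muM HM]]; exists M; split => //.
exists N => // k /= Nk; apply: fin_powS (HM (k - N)%N) => s /= [y [Ey [My Gy]]].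
by exists y; split => //; split => //; rewrite subnKC.
Qed.

Lemma fin_pow_sum_almost_on a (E : seq nat -> set T) :
  (forall s, measurable (E s)) ->
  (forall y, D y -> fin_pow_sum a [set s | E s y]) ->
  almost_on mu D (fun M => fin_pow_sum a [set s | E s `&` M !=set0]).
Proof.
move=> mE fE.
apply: (almost_on_forall (P := fun n M =>
    slot a n -> fin_pow n.+1 [set s | E s `&` M !=set0]))
      => [n M M' MM' H an|n].
  by apply: fin_powS (H an) => s [y [Ey /MM' My]]; exists y.
have [an|nan] := boolP (slot a n); last first.
  by move=> eta eta0; exists D; split => //; rewrite setDv measure0 lte_fin.
move=> eta eta0.
have [|M [mM MD muM HM]] := @fin_pow_almost_on n.+1 E mE _ eta eta0.
  by move=> y /fE; apply.
by exists M.
Qed.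

End almost_on.

Lemma fin_pow_sum_Egorov (R : realType) a :
  @Egorov R (seq nat) (fin_pow_sum a).
Proof.
move=> f_ f mf_ mf cvgf.
have mI : measurable (unit_itv R).
  by apply: sub_caratheodory; exact: measurable_itv.
have muI : (completed_lebesgue_measure (unit_itv R) < +oo)%E.
  have -> : completed_lebesgue_measure (unit_itv R) =
      lebesgue_measure `[0%R : R, 1%R] by [].
  by rewrite lebesgue_measure_itv /= lte_fin ltr01 /= -EFinD ltry.
(* Countably many thresholds suffice, so that a single [M] can serve them all; the functions are
   measurable only on the interval, hence the intersection with it. *)
pose E k s := [set y : lebesgueR R |
    unit_itv R y /\ (k.+1%:R^-1 <= `|f_ s y - f y|)%R].
have mE k s : measurable (E k s).
  have mg : measurable_fun (unit_itv R) (fun y => `|f_ s y - f y|)%R.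
    exact/measurableT_comp/measurable_funB.
  rewrite (_ : E k s = unit_itv R `&`
      (fun y => `|f_ s y - f y|)%R @^-1` `[k.+1%:R^-1%R, +oo[).
    exact: mg.
  by apply/seteqP; split => y /=; rewrite in_itv /= andbT.
have H : almost_on (@completed_lebesgue_measure R) (unit_itv R)
    (fun M => forall k, fin_pow_sum a [set s | E k s `&` M !=set0]).
  apply: (almost_on_forall mI (P := fun k M =>
    fin_pow_sum a [set s | E k s `&` M !=set0])) => [k M N MN|k].
    by apply: (idealS (fin_pow_sum_ideal a)) => s [y [Ey /MN My]]; exists y.
  apply: fin_pow_sum_almost_on => // y Iy.
  apply: (idealS (fin_pow_sum_ideal a)) (cvgf y Iy k.+1%:R^-1%R _) => [s []//|].
  by rewrite invr_gt0 ltr0n.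
move=> eta /H[M [mM MD muM HM]]; exists M; split => // e e0.
have [k ke] : exists k, (k.+1%:R^-1 < e)%R.
  have [k _ Hk] := near_infty_natSinv_lt (PosNum e0).
  by exists k; exact: (Hk k (leqnn k)).
apply: (idealS (fin_pow_sum_ideal a)) (HM k) => s [y My ey].
by exists y; split => //; split; [exact: MD|exact: le_trans (ltW ke) ey].
Qed.

Theorem theorem7p3 (R : realType) :
  exists (X : countType) (I : (nat -> bool) -> set (set X)),
    (forall a, [/\ is_ideal (I a), Egorov R (I a) &
                   Pi0_omega (powerset_family (I a))]) /\
    (forall a b, a <> b -> ~ ideal_iso (I a) (I b)).
Proof.
exists (seq nat), fin_pow_sum; split; last exact: fin_pow_sum_not_iso.
move=> a; split.
- exact: fin_pow_sum_ideal.
- exact: fin_pow_sum_Egorov.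
- exact: fin_pow_sum_Pi0_omega.
Qed.
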